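(* Let $(R,\mathfrak m)$ be a Noetherian local ring of dimension $1$ with infinite residue field $R/\mathfrak m$, let $I$ be an $\mathfrak m$-primary ideal, and let $\mathcal I=\{I_n\}_{n\in\mathbb Z}$ be an $I$-admissible filtration. Let $J=(x)\subseteq I_1$ be a minimal reduction of $\mathcal I$. Then $$e_1(\mathcal I)=\sum_{n=1}^{\infty}\bigl[\lambda(I_n/JI_{n-1})-\lambda((0:x)\cap I_{n-1})\bigr].$$ In particular, if $R$ is Cohen-Macaulay then $$e_1(\mathcal I)=\sum_{n=1}^{\infty}\lambda(I_n/JI_{n-1}).$$
   Context: Conventions: $\lambda$ denotes length as an $R$-module, $I^n=R$ for $n\le 0$, and $(0:x)=\{r\in R: rx=0\}$. A sequence of ideals $\mathcal I=\{I_n\}_{n\in\mathbb Z}$ is an $I$-admissible filtration if there is $k\in\mathbb N$ such that for all $m,n\in\mathbb Z$: $I_{n+1}\subseteq I_n$, $I_mI_n\subseteq I_{m+n}$, and $I^n\subseteq I_n\subseteq I^{n-k}$. In particular $I_n=R$ for $n\le 0$. For $\dim R=1$, the Hilbert function $H_{\mathcal I}(n)=\lambda(R/I_n)$ agrees for large $n$ with a polynomial $P_{\mathcal I}(n)=e_0(\mathcal I)n-e_1(\mathcal I)$ with integers $e_0(\mathcal I),e_1(\mathcal I)$; $e_1(\mathcal I)$ is called the Chern number of $\mathcal I$. A reduction of $\mathcal I$ is an ideal $J\subseteq I_1$ such that $JI_n=I_{n+1}$ for all large $n$. A minimal reduction is a reduction minimal with respect to inclusion; since $R/\mathfrak m$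 is infinite, minimal reductions exist and (in dimension one) are principal. *)

(* Defs.v *)
From mathcomp Require Import all_boot all_order all_algebra.
From mathcomp Require Import boolp classical_sets cardinality filter.
From mathcomp Require Import constructive_ereal.

Set Implicit Arguments.
Unset Strict Implicit.
Unset Printing Implicit Defensive.

Import GRing.Theory.
Local Open Scope classical_set_scope.
Local Open Scope ring_scope.

(** Ideals are sets [A : set R], not MathComp's [idealr]s, because an [idealr]
    is decidable and proper, while here [R] itself has to count as an ideal. *)

Section Ideals.
Variable R : comNzRingType.
Implicit Types A B I P M m : set R.

Definition is_ideal A : Prop :=
  [/\ A 0, forall a b, A a -> A b -> A (a + b) & forall r a, A a -> A (r * a)].

Definition ideal_gen (S : set R) : set R := smallest is_ideal S.

Definition principal_ideal (x : R) : set R := ideal_gen [set x].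

Definition ideal_mul A B : set R :=
  ideal_gen [set a * b | a in A & b in B].

Definition ideal_exp I (n : nat) : set R := iter n (ideal_mul I) setT.

(** [I ^ n = R] for [n <= 0]. *)
Definition ideal_expz I (n : int) : set R :=
  if n is Posz k then ideal_exp I k else setT.

(** [(0 : x)] *)
Definition annihilator (x : R) : set R := [set r | r * x = 0].

Definition prime_ideal P : Prop :=
  [/\ is_ideal P, P != setT & forall a b, P (a * b) -> P a \/ P b].

Definition maximal_ideal M : Prop :=
  [/\ is_ideal M, M != setT &
      forall A, is_ideal A -> A != setT -> M `<=` A -> A = M].

Definition radical A : set R := [set a | exists n : nat, A (a ^+ n)].

Definition primary_ideal A : Prop :=
  [/\ is_ideal A, A != setT &
      forall a b, A (a * b) -> A a \/ exists n : nat, A (b ^+ n)].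

Definition primary_to m A : Prop := primary_ideal A /\ radical A = m.

End Ideals.

Definition is_chain (R : comNzRingType) (C : set (set R)) (n : nat)
    (N : nat -> set R) : Prop :=
  (forall i, (i <= n)%N -> C (N i)) /\
  (forall i, (i < n)%N -> N i `<` N i.+1).

Definition max_chain_length (R : comNzRingType) (C : set (set R)) (n : nat)
    : Prop :=
  (exists N, is_chain C n N) /\ (forall k N, is_chain C k N -> (k <= n)%N).

Section Rings.
Variable R : comNzRingType.

Definition noetherian : Prop :=
  forall A : set R, is_ideal A -> exists s : seq R, A = ideal_gen [set` s].

Definition local_ring (m : set R) : Prop :=
  maximal_ideal m /\ forall M : set R, maximal_ideal M -> M = m.

Definition krull_dim (d : nat) : Prop :=
  max_chain_length (@prime_ideal R) d.

(** The underlying set of [R / m], as a set of cosets. *)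
Definition cosets (m : set R) : set (set R) :=
  range (fun x : R => [set y | m (y - x)]).

(** [s_i] is a nonzerodivisor on [R / (s_0, ..., s_(i-1))] for all [i], and
    [(s) <> R]. *)
Definition regular_seq (s : seq R) : Prop :=
  (forall i, (i < size s)%N -> forall a : R,
     ideal_gen [set` take i s] (s`_i * a) -> ideal_gen [set` take i s] a) /\
  ideal_gen [set` s] != setT.

Definition has_depth (m : set R) (d : nat) : Prop :=
  (exists s : seq R, [/\ [set` s] `<=` m, regular_seq s & size s = d]) /\
  (forall s : seq R, [set` s] `<=` m -> regular_seq s -> (size s <= d)%N).

Definition cohen_macaulay (m : set R) : Prop :=
  exists d, krull_dim d /\ has_depth m d.

(** The length of the [R]-module [A / B], for ideals [B `<=` A]: the submodules
    of [A / B] are the [N / B] with [N] an ideal such that [B `<=` N `<=` A].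
    The value is [+oo] when chains of submodules are arbitrarily long. *)
Definition length (A B : set R) : \bar int :=
  xget +oo%E
    [set n%:Z%:E | n in max_chain_length
                          [set N | [/\ is_ideal N, B `<=` N & N `<=` A]]].

End Rings.

Section Filtrations.
Variable R : comNzRingType.
Implicit Types (I J : set R) (F : int -> set R).

Definition admissible_filtration I F : Prop :=
  (forall n, is_ideal (F n)) /\
  exists k : nat, forall m n : int,
    [/\ F (n + 1) `<=` F n,
        ideal_mul (F m) (F n) `<=` F (m + n),
        ideal_expz I n `<=` F n &
        F n `<=` ideal_expz I (n - k%:Z)].

Definition reduction F J : Prop :=
  [/\ is_ideal J, J `<=` F 1 &
      \forall n \near \oo, ideal_mul J (F n%:Z) = F (n%:Z + 1)].

Definition minimal_reduction F J : Prop :=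
  reduction F J /\ forall J', reduction F J' -> J' `<=` J -> J' = J.

Definition hilbert_function F (n : int) : \bar int := length setT (F n).

(** In dimension one, [P(n) = e0 * n - e1] is the Hilbert polynomial of [F]. *)
Definition hilbert_coefficients F (e0 e1 : int) : Prop :=
  \forall n \near \oo, hilbert_function F n%:Z = (e0 * n%:Z - e1)%:E.

(** The coefficient [e1] of the Hilbert polynomial (in dimension one). *)
Definition chern_number F : int :=
  xget 0 [set e1 | exists e0, hilbert_coefficients F e0 e1].

End Filtrations.

(** [\sum_(n >= 1) u n = s] in the integers: the partial sums are eventually
    equal to [s]. As [s] is finite and [+oo - +oo = -oo], this also says that
    every [u n] is finite. *)
Definition series_from1 (u : nat -> \bar int) (s : int) : Prop :=
  \forall N \near \oo, (\sum_(1 <= n < N) u n)%E = s%:E.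

(* Main.v *)
(** Multiplication by [x] gives, for [n >= 1],
      [l(I_n / J I_(n-1)) - l((0 : x) :&: I_(n-1)) =
         (l(R / xR) - l(0 : x)) + l(R / I_(n-1)) - l(R / I_n)],
    so the partial sums telescope. For large [n] the left-hand side vanishes:
    [I_n = x I_(n-1)] eventually, so [I_n] lies in [x^j R] for [j] as large as
    desired, and [x^j R] meets [(0 : x)] trivially as soon as
    [(0 : x^j) = (0 : x^(j+1))]. Hence [l(R / I_n) = e_0 n - e_1] for large [n],
    with [e_0 = l(R / xR) - l(0 : x)], and the sum is [e_1]. *)

Require Import Defs.
From mathcomp Require Import all_boot all_order all_algebra.
From mathcomp Require Import boolp classical_sets cardinality filter.
From mathcomp Require Import constructive_ereal.
From mathcomp Require Import zify.

Set Implicit Arguments.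
Unset Strict Implicit.
Unset Printing Implicit Defensive.

Import GRing.Theory.
Local Open Scope classical_set_scope.
Local Open Scope ring_scope.

Section IdealTheory.
Variable R : comNzRingType.
Implicit Types A B C D M N P : set R.
Implicit Types x y r s : R.

(** * Sums, multiples and colons of ideals *)

Definition ideal_add A B : set R := [set a + b | a in A & b in B].

Definition scale_ideal x A : set R := [set x * a | a in A].

Definition colon_ideal A x : set R := [set r | A (r * x)].

Lemma ideal0 A : is_ideal A -> A 0. Proof. by case. Qed.

Lemma idealD A a b : is_ideal A -> A a -> A b -> A (a + b).
Proof. by case=> _ + _; apply. Qed.

Lemma idealM A r a : is_ideal A -> A a -> A (r * a).
Proof. by case=> _ _; apply. Qed.

Lemma idealMr A r a : is_ideal A -> A a -> A (a * r).
Proof. by rewrite mulrC; apply: idealM. Qed.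

Lemma idealB A a b : is_ideal A -> A a -> A b -> A (a - b).
Proof. by move=> iA Aa Ab; rewrite -mulN1r; apply: idealD => //; apply: idealM. Qed.

Lemma ideal_setT : is_ideal (setT : set R). Proof. by []. Qed.

Lemma ideal_set0 : is_ideal [set (0 : R)].
Proof. by split=> [//|a b -> ->|r a ->]; rewrite /= ?addr0 ?mulr0. Qed.

Lemma ideal_setI A B : is_ideal A -> is_ideal B -> is_ideal (A `&` B).
Proof.
move=> iA iB; split=> [|a b [Aa Ba] [Ab Bb]|r a [Aa Ba]].
- by split; apply: ideal0.
- by split; apply: idealD.
- by split; apply: idealM.
Qed.

Lemma is_ideal_add A B : is_ideal A -> is_ideal B -> is_ideal (ideal_add A B).
Proof.
move=> iA iB; split.
- by exists 0; [exact: ideal0|exists 0; [exact: ideal0|rewrite addr0]].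
- move=> _ _ [a Aa [b Bb <-]] [a' Aa' [b' Bb' <-]].
  exists (a + a'); first exact: idealD.
  by exists (b + b'); [exact: idealD|rewrite addrACA].
- move=> r _ [a Aa [b Bb <-]].
  by exists (r * a); [exact: idealM|exists (r * b); [exact: idealM|rewrite mulrDr]].
Qed.

Lemma sub_ideal_addl A B : is_ideal B -> A `<=` ideal_add A B.
Proof. by move=> iB a Aa; exists a => //; exists 0; rewrite ?addr0//; exact: ideal0. Qed.

Lemma sub_ideal_addr A B : is_ideal A -> B `<=` ideal_add A B.
Proof. by move=> iA b Bb; exists 0; [exact: ideal0|exists b; rewrite ?add0r]. Qed.

Lemma ideal_add_sub A B C : is_ideal C -> A `<=` C -> B `<=` C ->
  ideal_add A B `<=` C.
Proof. by move=> iC AC BC _ [a /AC Ca [b /BC Cb <-]]; apply: idealD. Qed.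

Lemma is_scale_ideal x A : is_ideal A -> is_ideal (scale_ideal x A).
Proof.
move=> iA; split=> [|_ _ [a Aa <-] [b Ab <-]|r _ [a Aa <-]].
- by exists 0; [exact: ideal0|rewrite mulr0].
- by exists (a + b); [exact: idealD|rewrite mulrDr].
- by exists (r * a); [exact: idealM|rewrite mulrCA].
Qed.

Lemma is_colon_ideal A x : is_ideal A -> is_ideal (colon_ideal A x).
Proof.
move=> iA; split=> [|a b|r a]; rewrite /colon_ideal /=.
- by rewrite mul0r; exact: ideal0.
- by rewrite mulrDl; exact: idealD.
- by rewrite -mulrA; exact: idealM.
Qed.

Lemma annihilatorE x : annihilator x = colon_ideal [set 0] x.
Proof. by []. Qed.

Lemma is_annihilator x : is_ideal (annihilator x).
Proof. by rewrite annihilatorE; apply: is_colon_ideal; exact: ideal_set0. Qed.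

Lemma is_ideal_gen (S : set R) : is_ideal (ideal_gen S).
Proof.
split=> [B [iB _]|a b Sa Sb B BS|r a Sa B BS]; first exact: ideal0.
- by apply: (idealD BS.1); [exact: Sa|exact: Sb].
- by apply: (idealM _ BS.1); exact: Sa.
Qed.

Lemma principal_idealE x : principal_ideal x = scale_ideal x setT.
Proof.
rewrite eqEsubset; split.
- apply: smallest_sub; first exact: is_scale_ideal ideal_setT.
  by move=> _ ->; exists 1; rewrite ?mulr1.
- move=> _ [r _ <-]; apply: (idealMr _ (is_ideal_gen _)).
  exact: sub_gen_smallest.
Qed.

Lemma ideal_mul_principal x A : is_ideal A ->
  ideal_mul (principal_ideal x) A = scale_ideal x A.
Proof.
move=> iA; rewrite eqEsubset; split.
- apply: smallest_sub; first exact: is_scale_ideal.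
  rewrite principal_idealE => _ [_ [r _ <-] [b Ab <-]].
  by exists (r * b); [exact: idealM|rewrite mulrA].
- move=> _ [a Aa <-]; apply: sub_gen_smallest; exists x; last by exists a.
  exact: sub_gen_smallest.
Qed.

Lemma ideal_gen_set0 : ideal_gen (set0 : set R) = [set 0].
Proof.
rewrite eqEsubset; split; first by apply: smallest_sub => //; exact: ideal_set0.
by move=> _ ->; exact: ideal0 (is_ideal_gen _).
Qed.

Lemma ideal_exp_expr A a n : A a -> ideal_exp A n (a ^+ n).
Proof.
move=> Aa; elim: n => [//|n IHn]; rewrite exprS.
by apply: sub_gen_smallest; exists a => //; exists (a ^+ n).
Qed.

(** * The maximal condition in Noetherian rings *)

Lemma sub_ideal_proper_ne A B : A `<=` B -> A <> B -> A `<` B.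
Proof. by move=> AB neAB; split=> // BA; apply: neAB; rewrite eqEsubset. Qed.

(** Otherwise choice builds a strictly ascending chain [S]. Its union is an ideal whose finitely
    many generators already lie in one [S n], so [S n.+1] cannot be larger. *)
Lemma noetherian_maximal (X : set (set R)) : noetherian R ->
  (forall A, X A -> is_ideal A) -> X !=set0 ->
  exists2 A, X A & forall B, X B -> A `<=` B -> B = A.
Proof.
move=> noR idX [A0 XA0]; apply: contrapT => nomax.
(* The implication sits inside the existential so that choice yields a total successor function
   [f]. *)
have next A : exists B, X A -> X B /\ A `<` B.
  have [XA|nXA] := pselect (X A); last by exists A.
  have [[B [XB AB]]|nB] := pselect (exists B, X B /\ A `<` B); first by exists B.
  case: nomax; exists A => // B XB AB; apply: contrapT => neBA.
  by apply: nB; exists B; split=> //; apply: sub_ideal_proper_ne => // /esym.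
have [f fP] := choice next.
pose S n := iter n f A0.
have XS n : X (S n) by elim: n => [//|n /fP[]].
have ltS n : S n `<` S n.+1 by have [] := fP _ (XS n).
have leS n k : (n <= k)%N -> S n `<=` S k.
  move=> /subnK <-; elim: (k - n)%N => [//|i IHi].
  by apply: subset_trans IHi _; exact: (ltS _).1.
have idU : is_ideal (\bigcup_n S n).
  split; first by exists 0%N => //; exact: ideal0 (idX _ XA0).
  - move=> a b [i _ ia] [j _ jb]; exists (maxn i j) => //.
    apply: (idealD (idX _ (XS _))).
    + exact: leS (leq_maxl _ _) _ ia.
    + exact: leS (leq_maxr _ _) _ jb.
  - by move=> r a [i _ ia]; exists i => //; apply: (idealM _ (idX _ (XS _))).
have [s Us] := noR _ idU.
have [n sn] : exists n, [set` s] `<=` S n.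
  have : [set` s] `<=` \bigcup_n S n by rewrite Us; exact: sub_gen_smallest.
  elim: s {Us} => [|a s IHs] sU; first by exists 0%N.
  have [|n sn] := IHs.
    by move=> b sb; apply: sU; rewrite /= inE; apply/orP; right.
  have [k _ ka] : (\bigcup_n S n) a by apply: sU; rewrite /= inE eqxx.
  exists (maxn n k) => b; rewrite /= inE => /orP[/eqP->|/sn].
  - exact: leS (leq_maxr _ _) _ ka.
  - exact: leS (leq_maxl _ _) _.
have [_] := ltS n; apply.
have SU : S n.+1 `<=` \bigcup_n S n by apply: bigcup_sup.
apply: subset_trans SU _.
by rewrite Us; apply: smallest_sub => //; exact: (idX _ (XS n)).
Qed.

(** * Chains of ideals and additivity of length *)

Definition ideal_interval A B : set (set R) :=
  [set N | [/\ is_ideal N, B `<=` N & N `<=` A]].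

Definition finite_length A B : Prop :=
  exists n, max_chain_length (ideal_interval A B) n.

(** A natural-number version of [length], with junk value [0] when the length
    is infinite. *)
Definition nat_length A B : nat :=
  xget 0%N (max_chain_length (ideal_interval A B)).

Lemma max_chain_length_unique (X : set (set R)) n k :
  max_chain_length X n -> max_chain_length X k -> n = k.
Proof.
move=> [[N cN] nmax] [[N' cN'] kmax].
by apply/eqP; rewrite eqn_leq (kmax _ _ cN) (nmax _ _ cN').
Qed.

Lemma nat_length_eq A B n :
  max_chain_length (ideal_interval A B) n -> nat_length A B = n.
Proof. by move=> mn; apply: xget_unique => // k /max_chain_length_unique; apply. Qed.

Lemma nat_lengthP A B : finite_length A B ->
  max_chain_length (ideal_interval A B) (nat_length A B).
Proof. exact: xgetPex. Qed.

Lemma lengthE A B : finite_length A B -> length A B = (nat_length A B)%:Z%:E.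
Proof.
move=> fAB; apply: xget_unique.
  by exists (nat_length A B) => //; exact: nat_lengthP.
by move=> _ [n /nat_length_eq -> <-].
Qed.

(** The one-term chain [A] shows that some chain exists, so bounded chain lengths have a maximum. *)
Lemma bounded_finite_length A B k : is_ideal A -> B `<=` A ->
  (forall n (N : nat -> set R), is_chain (ideal_interval A B) n N -> (n <= k)%N) ->
  finite_length A B.
Proof.
move=> iA BA bnd.
pose p n := `[< exists N : nat -> set R, is_chain (ideal_interval A B) n N >].
have ex : exists n, p n.
  exists 0%N; apply/asboolP; exists (fun=> A); split=> // i _; split=> //.
have ub n : p n -> (n <= k)%N by move=> /asboolP[N] /bnd.
case: (ex_maxnP ex ub) => n /asboolP pn nmax.
by exists n; split=> // j N cN; apply: nmax; apply/asboolP; exists N.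
Qed.

Lemma sub_chain (X Y : set (set R)) n (N : nat -> set R) : X `<=` Y ->
  is_chain X n N -> is_chain Y n N.
Proof. by move=> XY [XN ltN]; split=> // i /XN /XY. Qed.

Lemma ideal_interval_sub A B A' B' : A' `<=` A -> B `<=` B' ->
  ideal_interval A' B' `<=` ideal_interval A B.
Proof.
move=> A'A BB' N [iN B'N NA']; split=> //.
- exact: subset_trans B'N.
- exact: subset_trans A'A.
Qed.

Lemma sub_finite_length A B A' B' : is_ideal A' -> B' `<=` A' ->
  A' `<=` A -> B `<=` B' -> finite_length A B -> finite_length A' B'.
Proof.
move=> iA' B'A' A'A BB' [k [_ kmax]]; apply: (@bounded_finite_length _ _ k) => // n N.
by move=> /(sub_chain (ideal_interval_sub A'A BB')) /kmax.
Qed.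

Lemma sub_proper_trans A B C : A `<=` B -> B `<` C -> A `<` C.
Proof.
move=> AB [BC nCB]; split; first exact: subset_trans BC.
by move=> CA; apply: nCB; exact: subset_trans AB.
Qed.

(** At the junction [N1 q] and [N2 0] may coincide, so [N2 0] is skipped: the step from [N1 q] to
    [N2 1] is strict because the one from [N2 0] is. *)
Lemma chain_cat A B C p q (N1 N2 : nat -> set R) : C `<=` B -> B `<=` A ->
  is_chain (ideal_interval B C) q N1 -> is_chain (ideal_interval A B) p N2 ->
  is_chain (ideal_interval A C) (q + p)
    (fun i => if (i <= q)%N then N1 i else N2 (i - q)%N).
Proof.
move=> CB BA [N1i ltN1] [N2i ltN2]; split=> i ip.
- case: leqP => iq; first exact: ideal_interval_sub BA _ _ (N1i _ iq).
  have ipq : (i - q <= p)%N by rewrite leq_subLR.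
  exact: ideal_interval_sub CB _ (N2i _ ipq).
- have [iq|qi|eqi] := ltngtP i q.
  + exact: ltN1.
  + by rewrite (subSn (ltnW qi)); apply: ltN2; lia.
  + rewrite eqi subSn // subnn.
    have [_ _ N1B] := N1i q (leqnn _).
    have [|_ BN2 _] := N2i 0%N; first by [].
    have p0 : (0 < p)%N by rewrite -(ltn_add2l q) addn0 -{1}eqi.
    by apply: sub_proper_trans (ltN2 0%N p0); exact: subset_trans BN2.
Qed.

(** A longest chain between [C] and [B] is prolonged by the strict step from [B] to [A]. *)
Lemma nat_lengthSn A B C : is_ideal A -> is_ideal B -> C `<=` B -> B `<` A ->
  finite_length A C -> (nat_length B C < nat_length A C)%N.
Proof.
move=> iA iB CB BA fAC; have [BA' _] := BA.
have fBC : finite_length B C by apply: sub_finite_length fAC.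
have [[N cN] _] := nat_lengthP fBC; have [_ kmax] := nat_lengthP fAC.
have cBA : is_chain (ideal_interval A B) 1 (fun i => if i == 0%N then B else A).
  by split=> [[|i] _|[|//] _] //=; split.
by have /kmax := chain_cat CB BA' cN cBA; rewrite addn1.
Qed.

Lemma leq_nat_length A B C : is_ideal A -> is_ideal B -> C `<=` B -> B `<=` A ->
  finite_length A C -> (nat_length B C <= nat_length A C)%N.
Proof.
move=> iA iB CB BA fAC; have [<-//|neBA] := pselect (B = A).
by apply: ltnW; apply: nat_lengthSn => //; exact: sub_ideal_proper_ne.
Qed.

(** For [a] in [N'] write [a = b + c] with [b] in [N] and [c] in [B]; then [c = a - b] lies in both
    [N'] and [B], hence in [N]. *)
Lemma ideal_modular N N' B : is_ideal N' -> N `<=` N' -> is_ideal N ->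
  N' `&` B `<=` N -> ideal_add N' B `<=` ideal_add N B -> is_ideal B -> N' `<=` N.
Proof.
move=> iN' NN' iN I' A' iB a N'a.
have [b Nb [c Bc eqa]] := A' a (sub_ideal_addl iB N'a).
rewrite -eqa; apply: idealD => //; apply: I'; split=> //.
have -> : c = a - b by rewrite -eqa addrC addKr.
by apply: idealB => //; exact: NN'.
Qed.

(** Along a chain [N_i], the sum of the lengths of [(N_i :&: B) / C] and
    [(N_i + B) / B] increases strictly, by the modular law. *)
Lemma nat_lengthD A B C : is_ideal A -> is_ideal B -> is_ideal C ->
  C `<=` B -> B `<=` A -> finite_length A B -> finite_length B C ->
  finite_length A C /\ nat_length A C = (nat_length A B + nat_length B C)%N.
Proof.
move=> iA iB iC CB BA fAB fBC.
have bnd n (N : nat -> set R) : is_chain (ideal_interval A C) n N ->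
    (n <= nat_length A B + nat_length B C)%N.
  move=> [Ni ltN].
  have step i : (i <= n)%N ->
    [/\ is_ideal (N i `&` B), is_ideal (ideal_add (N i) B), C `<=` N i `&` B,
        B `<=` ideal_add (N i) B & ideal_add (N i) B `<=` A].
    move=> /Ni[iN CN NA]; split.
    - exact: ideal_setI.
    - exact: is_ideal_add.
    - by move=> c Cc; split; [exact: CN|exact: CB].
    - exact: sub_ideal_addr.
    - exact: ideal_add_sub.
  suff incr i : (i <= n)%N ->
      (i <= nat_length (ideal_add (N i) B) B + nat_length (N i `&` B) C)%N.
    apply: leq_trans (incr n (leqnn n)) _; have [iI iD CI BD DA] := step n (leqnn n).
    by apply: leq_add; apply: leq_nat_length.
  elim: i => [//|i IHi] lin.
  have {IHi} := IHi (ltnW lin).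
  have [iI iD CI BD DA] := step i (ltnW lin).
  have [iI' iD' CI' BD' DA'] := step i.+1 lin.
  have [NN' nN'N] := ltN i lin.
  have [iN _ _] := Ni _ (ltnW lin); have [iN' _ _] := Ni _ lin.
  have II : N i `&` B `<=` N i.+1 `&` B by apply: setSI.
  have DD : ideal_add (N i) B `<=` ideal_add (N i.+1) B.
    apply: ideal_add_sub => //; apply: subset_trans NN' _; exact: sub_ideal_addl.
  have fI : finite_length (N i.+1 `&` B) C by apply: sub_finite_length fBC.
  have fD : finite_length (ideal_add (N i.+1) B) B by apply: sub_finite_length fAB.
  have leI := leq_nat_length iI' iI CI II fI.
  have leD := leq_nat_length iD' iD BD DD fD.
  (* If neither the intersection nor the sum grew, the modular law would contradict the strictness
     of the chain. *)
  have [I'I|nI] := pselect (N i.+1 `&` B `<=` N i `&` B); last first.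
    by have := nat_lengthSn iI' iI CI (conj II nI) fI; lia.
  have [D'D|nD] := pselect (ideal_add (N i.+1) B `<=` ideal_add (N i) B); last first.
    by have := nat_lengthSn iD' iD BD (conj DD nD) fD; lia.
  case: nN'N; apply: ideal_modular D'D iB => //.
  by apply: subset_trans I'I _ => ? [].
have fAC : finite_length A C.
  by apply: bounded_finite_length bnd => //; exact: subset_trans BA.
split=> //; apply/eqP; rewrite eqn_leq; apply/andP; split.
  by have [[N cN] _] := nat_lengthP fAC; apply: bnd cN.
(* The reverse inequality comes from concatenating two longest chains. *)
have [[N1 c1] _] := nat_lengthP fAB; have [[N2 c2] _] := nat_lengthP fBC.
have [_ kmax] := nat_lengthP fAC.
by rewrite addnC; apply: kmax (chain_cat CB BA c2 c1).
Qed.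

Lemma finite_length_self A : is_ideal A -> finite_length A A.
Proof.
move=> iA; apply: (@bounded_finite_length _ _ 0) => // -[//|n] N [Ni ltN].
have [_] := ltN 0%N isT; case; have [//|_ AN0 _] := Ni 0%N.
by have [//|_ _ N1A] := Ni 1%N; exact: subset_trans AN0.
Qed.

(** Additivity with all three ideals equal to [A] reads [l = l + l]. *)
Lemma nat_length_self A : is_ideal A -> nat_length A A = 0%N.
Proof.
move=> iA; have fAA := finite_length_self iA.
have [_ eqA] := nat_lengthD iA iA iA (@subset_refl _ A) (@subset_refl _ A) fAA fAA.
by apply/eqP; rewrite -(eqn_add2l (nat_length A A)) addn0 -eqA.
Qed.

(** * Lengths of isomorphic quotients *)

(** The map [f] carries a longest chain of [X] into [Y], and [g] carries every chain of [Y] back to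
    [X], where [n] bounds its length. *)
Lemma max_chain_length_iso (X Y : set (set R)) (f g : set R -> set R) n :
  (forall N, X N -> Y (f N)) -> (forall M, Y M -> X (g M)) ->
  (forall N N', X N -> X N' -> N `<` N' -> f N `<` f N') ->
  (forall M M', Y M -> Y M' -> M `<` M' -> g M `<` g M') ->
  max_chain_length X n -> max_chain_length Y n.
Proof.
move=> fY gX ltf ltg [[N [XN ltN]] nmax]; split.
- exists (f \o N); split=> i lin /=; first exact/fY/XN.
  by apply: ltf; [exact/XN/ltnW|exact: XN|exact: ltN].
- move=> k M [YM ltM]; apply: (nmax _ (g \o M)); split=> i lik /=.
  + exact/gX/YM.
  + by apply: ltg; [exact/YM/ltnW|exact: YM|exact: ltM].
Qed.

(** The second isomorphism theorem on submodules: [N] goes to [N + B], and [M] back to its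
    intersection with [A]. The modular law makes the first map strictly increasing. *)
Lemma nat_length_second_iso A B : is_ideal A -> is_ideal B ->
  finite_length A (A `&` B) ->
  finite_length (ideal_add A B) B /\
  nat_length (ideal_add A B) B = nat_length A (A `&` B).
Proof.
move=> iA iB fAB.
suff h : max_chain_length (ideal_interval (ideal_add A B) B) (nat_length A (A `&` B)).
  by split; [exists (nat_length A (A `&` B))|exact: nat_length_eq].
apply: (@max_chain_length_iso _ _ (ideal_add^~ B) (setI^~ A)) (nat_lengthP fAB).
- move=> N [iN IN NA]; split.
  + exact: is_ideal_add.
  + exact: sub_ideal_addr.
  + apply: ideal_add_sub; [exact: is_ideal_add| |exact: sub_ideal_addr].
    by apply: subset_trans NA _; exact: sub_ideal_addl.
- move=> M [iM BM MAB]; split; first exact: ideal_setI.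
  + by move=> a [Aa /BM Ma].
  + by move=> a [].
- move=> N N' [iN IN NA] [iN' IN' NA'] [NN' nN'N]; split.
    apply: ideal_add_sub; [exact: is_ideal_add| |exact: sub_ideal_addr].
    by apply: subset_trans NN' _; exact: sub_ideal_addl.
  move=> D'D; apply: nN'N; apply: ideal_modular D'D iB => // a [N'a Ba].
  by apply: IN; split=> //; exact: NA'.
- move=> M M' [iM BM MAB] [iM' BM' MAB'] [MM' nM'M]; split; first exact: setSI.
  move=> I'I; apply: nM'M => c M'c; have [a Aa [b Bb eqc]] := MAB' c M'c.
  have [Ma _] : (M `&` A) a.
    apply: I'I; split=> //; have -> : a = c - b by rewrite -eqc addrK.
    by apply: idealB => //; exact: BM'.
  by rewrite -eqc; apply: idealD => //; exact: BM.
Qed.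

(** Multiplication by [x] induces [R / (A + (0 : x)) ~ xR / xA]. *)
Lemma nat_length_scale x A : is_ideal A ->
  finite_length setT (ideal_add A (annihilator x)) ->
  finite_length (scale_ideal x setT) (scale_ideal x A) /\
  nat_length (scale_ideal x setT) (scale_ideal x A) =
    nat_length setT (ideal_add A (annihilator x)).
Proof.
move=> iA fA; have iK := is_annihilator x.
set K := annihilator x in iK fA *.
suff h : max_chain_length (ideal_interval (scale_ideal x setT) (scale_ideal x A))
    (nat_length setT (ideal_add A K)).
  by split; [exists (nat_length setT (ideal_add A K))|exact: nat_length_eq].
(* The maps are [N] to [xN] and [M] to [(M : x)]. The first is strict because [N] contains
   [(0 : x)], the second because [M] lies in [xR]. *)
apply: (@max_chain_length_iso _ _ (scale_ideal x) (colon_ideal^~ x)) (nat_lengthP fA).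
- move=> N [iN AN _]; split.
  + exact: is_scale_ideal.
  + by apply: image_subset; apply: subset_trans AN; exact: sub_ideal_addl.
  + exact: image_subset.
- move=> M [iM AM _]; split=> //; first exact: is_colon_ideal.
  apply: ideal_add_sub; first exact: is_colon_ideal.
  + by move=> a Aa; apply: AM; exists a => //; rewrite mulrC.
  + by move=> a; rewrite /K /annihilator /colon_ideal /= => ->; exact: ideal0.
- move=> N N' [iN AN _] [iN' _ _] [NN' nN'N]; split; first exact: image_subset.
  move=> xN'N; apply: nN'N => a N'a; have [|b Nb eqab] := xN'N (x * a); first by exists a.
  have -> : a = b + (a - b) by rewrite addrC subrK.
  apply: idealD => //; apply: AN; apply: (sub_ideal_addr iA).
  by rewrite /K /annihilator /= mulrBl ![_ * x]mulrC eqab subrr.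
- move=> M M' [iM _ _] [iM' _ MxR] [MM' nM'M]; split; first by move=> a /MM'.
  move=> cM'M; apply: nM'M => a M'a; have [r _ eqr] := MxR a M'a.
  rewrite -eqr mulrC; apply: cM'M.
  by rewrite /colon_ideal /= mulrC eqr.
Qed.

(** * Finite length of torsion modules *)

(** If not, take [C] maximal among the [C] between [B] and [A] with [A / C] of
    infinite length; an associated prime of [A / C] contains, hence equals,
    [m], and yields a simple submodule of [A / C]. *)
Lemma torsion_finite_length (m A B : set R) : noetherian R -> maximal_ideal m ->
  is_ideal A -> is_ideal B -> B `<=` A ->
  (forall y a, m y -> A a -> exists j, B (y ^+ j * a)) -> finite_length A B.
Proof.
move=> noR [im mT mmax] iA iB BA tors; apply: contrapT => nfAB.
have [||C [iC BC CA nfC] Cmax] := @noetherian_maximal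
  [set C | [/\ is_ideal C, B `<=` C, C `<=` A & ~ finite_length A C]] noR.
- by move=> C [].
- by exists B; split.
have nAC : ~ A `<=` C.
  move=> AC; apply: nfC; have -> : C = A by rewrite eqEsubset.
  exact: finite_length_self.
have [s0 As0 nCs0] : exists2 s, A s & ~ C s.
  by apply: contrapT => h; apply: nAC => a Aa; apply: contrapT => nCa; apply: h; exists a.
have [||_ [s [As nCs] <-] Pmax] := @noetherian_maximal
  [set colon_ideal C s | s in [set s | A s /\ ~ C s]] noR.
- by move=> _ [s _ <-]; exact: is_colon_ideal.
- by exists (colon_ideal C s0), s0.
set P := colon_ideal C s in Pmax.
have iP : is_ideal P by exact: is_colon_ideal.
have P1 : ~ P 1 by rewrite /P /colon_ideal /= mul1r.
(* Since [b * s] is not in [C] and [(C : b * s)] contains [P], maximality makes the two colons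
   equal. *)
have primeP a b : P (a * b) -> ~ P b -> P a.
  move=> Pab nPb; rewrite -(Pmax (colon_ideal C (b * s))).
  - by move: Pab; rewrite /P /colon_ideal /= mulrA.
  - by exists (b * s) => //; split=> //; exact: idealM.
  - by move=> c Pc; rewrite /colon_ideal /= mulrCA; exact: idealM.
have mP : m `<=` P.
  move=> y my; have [j /BC Pj] := tors _ _ my As.
  have {Pj} : P (y ^+ j) by [].
  elim: j => [//|j IHj]; rewrite exprS => Py.
  have [/IHj//|nPj] := pselect (P (y ^+ j)); exact: primeP Py nPj.
have {mP} eqP : P = m.
  by apply: mmax => //; apply/eqP => PT; apply: P1; rewrite PT.
pose D := ideal_add C (scale_ideal s setT).
have iS : is_ideal (scale_ideal s setT) by exact: is_scale_ideal.
have iD : is_ideal D by exact: is_ideal_add.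
have CD : C `<=` D by exact: sub_ideal_addl.
have Ds : D s by apply: sub_ideal_addr => //; exists 1; rewrite ?mulr1.
have DA : D `<=` A by apply: ideal_add_sub => // _ [r _ <-]; exact: idealMr.
(* [D] is strictly larger than [C], as it contains [s], so the maximality of [C] applies. *)
have fAD : finite_length A D.
  apply: contrapT => nfAD; apply: nCs; rewrite -(Cmax D) //.
  by split=> //; exact: subset_trans CD.
(* Simplicity of [D / C]: an element of [N] outside [C] gives [s * r] in [N] with [r] outside
   [P = m]. Then [1 = p + r * t] with [p] in [m], and [s = p * s + r * t * s] lies in [N]. *)
have simpleD N : is_ideal N -> C `<` N -> N `<=` D -> D `<=` N.
  move=> iN [CN nNC] ND.
  have [n Nn nCn] : exists2 n, N n & ~ C n.
    by apply: contrapT => h; apply: nNC => a Aa; apply: contrapT => nCa; apply: h; exists a.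
  have [c Cc [_ [r _ <-] eqn]] := ND n Nn.
  have Nrs : N (s * r).
    have -> : s * r = n - c by rewrite -eqn addrC addKr.
    by apply: idealB => //; exact: CN.
  have nPr : ~ P r.
    by move=> Pr; apply: nCn; rewrite -eqn mulrC; exact: idealD.
  have [p Pp [_ [t _ <-] eq1]] : ideal_add m (scale_ideal r setT) 1.
    have [->//|] := eqVneq (ideal_add m (scale_ideal r setT)) setT.
    have ir : is_ideal (scale_ideal r setT) by exact: is_scale_ideal.
    move=> /(mmax _ (is_ideal_add im ir))/(_ (sub_ideal_addl ir)) eqm.
    case: nPr; rewrite eqP -eqm.
    by apply: sub_ideal_addr => //; exists 1; rewrite ?mulr1.
  rewrite -eqP in Pp.
  apply: ideal_add_sub => // _ [u _ <-]; apply: idealMr => //.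
  rewrite -[s]mul1r -eq1 mulrDl; apply: idealD => //; first exact: CN.
  by rewrite mulrAC [r * s]mulrC; exact: idealMr.
have fDC : finite_length D C.
  apply: (@bounded_finite_length _ _ 1) => // -[|[|n]] // N [Ni ltN].
  have [//|_ CN0 _] := Ni 0%N; have [//|iN1 _ N1D] := Ni 1%N.
  have [//|_ _ N2D] := Ni 2%N; have [_] := ltN 1%N isT; case.
  apply: subset_trans N2D _; apply: simpleD => //.
  exact: sub_proper_trans CN0 (ltN 0%N isT).
by apply: nfC; have [] := nat_lengthD iA iD iC CD DA fAD fDC.
Qed.

(** * Lengths under multiplication by [x] *)

(** Choose [j] with [(0 : x^j)] maximal, hence equal to [(0 : x^(j+1))]. If [x] kills [x^j f], then
    [f] is in the latter, so [x^j f = 0]. *)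
Lemma annihilator_setI_scale_exp x : noetherian R ->
  exists j, annihilator x `&` scale_ideal (x ^+ j) setT `<=` [set 0].
Proof.
move=> noR; have [||_ [j _ <-] jmax] := @noetherian_maximal
  [set annihilator (x ^+ j) | j in [set: nat]] noR.
- by move=> _ [j _ <-]; exact: is_annihilator.
- by exists (annihilator (x ^+ 0)), 0%N.
exists j => d [] /[swap] -[f _ <-] Kd; rewrite /= mulrC.
have fS : annihilator (x ^+ j.+1) f.
  by move: Kd; rewrite /annihilator /= exprSr mulrA [f * _]mulrC.
suff : annihilator (x ^+ j) f by [].
rewrite -(jmax (annihilator (x ^+ j.+1))) //.
by move=> a; rewrite /annihilator /= exprSr mulrA => ->; rewrite mul0r.
Qed.

(** Both [R / B] and [R / xR] are quotients of [R / xA]; the kernels are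
    [B / xA] and [xR / xA ~ R / (A + (0 : x))], and
    [(A + (0 : x)) / A ~ (0 : x) / ((0 : x) :&: A)]. *)
Lemma nat_length_multiplication x A B : is_ideal A -> is_ideal B ->
  scale_ideal x A `<=` B ->
  finite_length setT (scale_ideal x setT) -> finite_length setT A ->
  finite_length (annihilator x) [set 0] ->
  [/\ finite_length setT B, finite_length B (scale_ideal x A),
      finite_length (annihilator x `&` A) [set 0] &
      (nat_length B (scale_ideal x A) + nat_length setT B +
         nat_length (annihilator x) [set 0%R] =
       nat_length setT (scale_ideal x setT) + nat_length setT A +
         nat_length (annihilator x `&` A) [set 0%R])%N].
Proof.
move=> iA iB xAB fxR fA fK; have iK := is_annihilator x.
set K := annihilator x in iK fK *.
have iT := ideal_setT; have i0 := ideal_set0.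
have ixA := is_scale_ideal x iA; have ixR := is_scale_ideal x iT.
have iKA := ideal_setI iK iA; have iS := is_ideal_add iK iA.
have zero_sub C : is_ideal C -> [set 0] `<=` C by move=> /ideal0 C0 _ ->.
have subKA : K `&` A `<=` K by move=> ? [].
have fKA : finite_length (K `&` A) [set 0].
  by apply: sub_finite_length fK => //; exact: zero_sub.
have fK' : finite_length K (K `&` A).
  by apply: sub_finite_length fK => //; exact: zero_sub.
have [_ eqK] := nat_lengthD iK iKA i0 (zero_sub _ iKA) subKA fK' fKA.
have AS : A `<=` ideal_add K A by exact: sub_ideal_addr.
have [fSA eqSA] := nat_length_second_iso iK iA fK'.
have fS : finite_length setT (ideal_add K A) by apply: sub_finite_length fA.
have [_ eqA] := nat_lengthD iT iS iA AS (@subsetT _ _) fS fSA.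
have SE : ideal_add A K = ideal_add K A.
  rewrite eqEsubset; split; apply: ideal_add_sub => //.
  - exact: sub_ideal_addl.
  - exact: is_ideal_add.
  - exact: sub_ideal_addr.
  - exact: sub_ideal_addl.
have := @nat_length_scale x A iA; rewrite -/K SE => /(_ fS)[fxRA eqx].
have xAxR : scale_ideal x A `<=` scale_ideal x setT by exact: image_subset.
have [fxA eqxA] := nat_lengthD iT ixR ixA xAxR (@subsetT _ _) fxR fxRA.
(* Finiteness passes from [R / xA] to its quotient [R / B] and its submodule [B / xA]. *)
have fB : finite_length setT B by apply: sub_finite_length fxA.
have fBx : finite_length B (scale_ideal x A) by apply: sub_finite_length fxA.
have [_ eqB] := nat_lengthD iT iB ixA xAB (@subsetT _ _) fB fBx.
split=> //.
(* With [L] the intersection of [K] and [A], both sides equal [l(R / xR) + l(R / (K + A)) + l(K / L)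
   + l(L)]. *)
by rewrite [(_ + nat_length setT B)%N]addnC -eqB eqxA eqx eqK eqA eqSA !addnA.
Qed.

(** Each index beyond [n0] contributes one factor [x]. *)
Lemma reduction_scale_exp (F : nat -> set R) x n0 :
  (forall n, (n0 <= n)%N -> F n.+1 = scale_ideal x (F n)) ->
  forall j n, (n0 + j <= n)%N -> F n `<=` scale_ideal (x ^+ j) setT.
Proof.
move=> redF; elim=> [|j IHj] n len; first by move=> a _; exists a; rewrite ?mul1r.
case: n len => [|n]; rewrite addnS // ltnS => len.
rewrite redF; last exact: leq_trans (leq_addr _ _) len.
move=> _ [a /(IHj _ len)[b _ <-] <-]; exists b => //.
by rewrite exprS mulrA.
Qed.

End IdealTheory.

(** * The Hilbert function and the Chern number of the filtration *)

Section ChernNumber.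
Variable R : comNzRingType.
Variables (m I : set R) (F : int -> set R) (x : R).
Hypothesis noR : noetherian R.
Hypothesis max_m : maximal_ideal m.
Hypothesis rad_I : radical I = m.
Hypothesis admF : admissible_filtration I F.
Hypothesis redF : reduction F (principal_ideal x).

Let idF n : is_ideal (F n). Proof. by case: admF. Qed.

Lemma filtration0 : F 0 = setT.
Proof.
rewrite eqEsubset; split=> //.
by case: admF => _ [k /(_ 0 0)[]].
Qed.

(** If [y^k] is in [I], then [y^(kn)] is in [I^n], which [I_n] contains. *)
Lemma pow_mem_filtration y n : m y -> exists j, F (Posz n) (y ^+ j).
Proof.
rewrite -rad_I => -[k Iyk]; exists (k * n)%N; rewrite exprM.
have [_ [_ /(_ 0 n%:Z)[_ _ + _]]] := admF; apply.
exact: ideal_exp_expr.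
Qed.

Lemma reduction_eventually : exists n0, forall n, (n0 <= n)%N ->
  F (Posz n.+1) = scale_ideal x (F (Posz n)).
Proof.
case: redF => _ _ [n0 _ H]; exists n0 => n n0n.
by rewrite -addn1 PoszD -H // ideal_mul_principal.
Qed.

Lemma finite_colength n : finite_length setT (F (Posz n)).
Proof.
apply: (torsion_finite_length noR max_m) => // y a my _.
by have [j Fyj] := pow_mem_filtration n my; exists j; exact: idealMr.
Qed.

(** Some power of [y] lies in [I_(n+1) = x I_n] for a large [n], hence in [xR]. *)
Lemma pow_mem_reduction y : m y -> exists j, scale_ideal x setT (y ^+ j).
Proof.
move=> my; have [n0 redn0] := reduction_eventually.
have [j] := pow_mem_filtration n0.+1 my; rewrite redn0 // => -[a _ eqa].
by exists j; exists a.
Qed.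

Lemma finite_length_mod_reduction : finite_length setT (scale_ideal x setT).
Proof.
have ixR := is_scale_ideal x (@ideal_setT R).
apply: (torsion_finite_length noR max_m) => // y a /pow_mem_reduction[j xRyj] _.
by exists j; exact: idealMr.
Qed.

(** A power of each [y] in [m] is a multiple of [x], so it kills [(0 : x)]. *)
Lemma finite_length_annihilator : finite_length (annihilator x) [set 0].
Proof.
apply: (torsion_finite_length noR max_m).
- exact: is_annihilator.
- exact: ideal_set0.
- by move=> _ ->; exact: ideal0 (is_annihilator x).
- move=> y a /pow_mem_reduction[j [r _ eqy]] Ka; exists j.
  by rewrite /= -eqy mulrAC [x * a]mulrC Ka mul0r.
Qed.

Lemma scale_filtration_sub n : scale_ideal x (F (Posz n)) `<=` F (Posz n.+1).
Proof.
have [_ JF1 _] := redF; have [_ [_ /(_ 1 n%:Z)[_ F1n _ _]]] := admF.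
move=> _ [a Fa <-]; rewrite -add1n PoszD; apply: F1n.
apply: sub_gen_smallest; exists x; last by exists a.
by apply: JF1; exact: sub_gen_smallest.
Qed.

Let h n := nat_length setT (F (Posz n)).
(** This constant turns out to be the coefficient [e_0]. *)
Let c : int :=
  (nat_length setT (scale_ideal x setT))%:Z - (nat_length (annihilator x) [set 0])%:Z.

Lemma chern_term_finite n :
  finite_length (F (Posz n.+1)) (ideal_mul (principal_ideal x) (F (Posz n))) /\
  finite_length (annihilator x `&` F (Posz n)) [set 0].
Proof.
rewrite ideal_mul_principal //.
by have [] := nat_length_multiplication (idF n) (idF n.+1) (@scale_filtration_sub n)
  finite_length_mod_reduction (finite_colength n) finite_length_annihilator.
Qed.

(** The summand of index [n.+1] of the series, computed in the integers. *)
Definition chern_term n : int :=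
  (nat_length (F (Posz n.+1)) (ideal_mul (principal_ideal x) (F (Posz n))))%:Z -
  (nat_length (annihilator x `&` F (Posz n)) [set 0])%:Z.

Lemma chern_termE n : chern_term n = c + (h n)%:Z - (h n.+1)%:Z.
Proof.
rewrite /chern_term ideal_mul_principal //.
have [_ _ _] := nat_length_multiplication (idF n) (idF n.+1) (@scale_filtration_sub n)
  finite_length_mod_reduction (finite_colength n) finite_length_annihilator.
rewrite /c /h; lia.
Qed.

(** The sum telescopes, and [h 0 = 0] because [I_0 = R]. *)
Lemma sum_chern_term n : \sum_(0 <= i < n) chern_term i = c * n%:Z - (h n)%:Z.
Proof.
elim: n => [|n IHn].
  by rewrite big_geq // /h filtration0 (nat_length_self (@ideal_setT R)) mulr0 subrr.
by rewrite big_nat_recr //= IHn chern_termE; lia.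
Qed.

Lemma chern_term_eventually0 : exists n1, forall n, (n1 <= n)%N -> chern_term n = 0.
Proof.
have [n0 redn0] := reduction_eventually.
have [j Kj] := annihilator_setI_scale_exp x noR.
(* From [n0] on the first length vanishes; [j] further steps put [I_n] inside [x^j R], and the
   second vanishes too. *)
exists (n0 + j)%N => n len.
have n0n : (n0 <= n)%N by apply: leq_trans len; exact: leq_addr.
rewrite /chern_term ideal_mul_principal // -redn0 // (nat_length_self (idF n.+1)).
suff -> : annihilator x `&` F (Posz n) = [set 0].
  by rewrite (nat_length_self (@ideal_set0 R)).
rewrite eqEsubset; split.
- move=> a [Ka Fa]; apply: Kj; split=> //.
  exact: (reduction_scale_exp redn0) len _ Fa.
- by move=> _ ->; split; [exact: ideal0 (is_annihilator x)|exact: ideal0].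
Qed.

(** Once the partial sums are constant, equal to [s], the telescoped formula reads
    [h n = c * n - s], which is the Hilbert polynomial. *)
Lemma sum_chern_term_eventually : exists n1, forall n, (n1 <= n)%N ->
  \sum_(0 <= i < n) chern_term i = chern_number F.
Proof.
have [n1 ct0] := chern_term_eventually0.
pose s := \sum_(0 <= i < n1) chern_term i.
have sE n : (n1 <= n)%N -> \sum_(0 <= i < n) chern_term i = s.
  move=> len; rewrite (big_cat_nat (leq0n n1) len) /= [X in _ + X]big1_seq ?addr0 //.
  by move=> i /andP[_]; rewrite mem_index_iota => /andP[/ct0].
suff -> : chern_number F = s by exists n1.
have hE n : hilbert_function F n%:Z = ((h n)%:Z)%:E.
  exact: lengthE (finite_colength n).
(* [chern_number] is a chosen value, so [s] has to be shown to qualify and to be the only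
   candidate. *)
apply: xget_unique.
- exists c; exists n1 => // n /= len; rewrite hE; congr (_%:E).
  by have := sum_chern_term n; rewrite sE //; lia.
- move=> e1 [e0 [n2 _ hilb]].
  have hp n : (n1 <= n)%N -> (n2 <= n)%N -> e0 * n%:Z - e1 = c * n%:Z - s.
    move=> len1 len2; have := hilb n len2; rewrite /= hE => -[<-].
    by have := sum_chern_term n; rewrite sE //; lia.
  (* Agreement at two consecutive large integers determines both coefficients of a linear
     polynomial. *)
  have := hp (n1 + n2)%N (leq_addr _ _) (leq_addl _ _).
  have := hp (n1 + n2).+1 (leqW (leq_addr _ _)) (leqW (leq_addl _ _)).
  nia.
Qed.

End ChernNumber.

(** * The Cohen-Macaulay case and the conclusion *)

(** The depth equals the dimension [1], so [m] contains a regular sequence with one term [y];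
    regularity is then modulo the ideal generated by the empty set, which is zero. *)
Lemma cohen_macaulay_dim1_nonzerodivisor (R : comNzRingType) (m : set R) :
  krull_dim R 1 -> cohen_macaulay m ->
  exists2 y, m y & forall a, y * a = 0 -> a = 0.
Proof.
move=> dim1 [d [/(max_chain_length_unique dim1) <-]].
move=> [[s [sm [reg _] size1]] _]; case: s size1 sm reg => [|y []] // _ sm reg.
exists y.
  by apply: sm; rewrite /= inE.
move=> a ya0; have := reg 0%N isT a.
rewrite /= set_nil ideal_gen_set0; exact.
Qed.

Theorem theorem2p1 (R : comNzRingType) (m : set R) (I : set R)
    (F : int -> set R) (x : R) :
  noetherian R ->
  local_ring m ->
  krull_dim R 1 ->
  infinite_set (cosets m) ->
  primary_to m I ->
  admissible_filtration I F ->
  let J := principal_ideal x in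
  minimal_reduction F J ->
  series_from1
    (fun n => length (F n%:Z%R) (ideal_mul J (F (n%:Z - 1)%R))
              - length (annihilator x `&` F (n%:Z - 1)%R) [set 0%R])%E
    (chern_number F)
  /\
  (cohen_macaulay m ->
   series_from1
     (fun n => length (F n%:Z%R) (ideal_mul J (F (n%:Z - 1)%R)))
     (chern_number F)).
Proof.
move=> noR [max_m _] dim1 _ [_ rad_I] admF J [redF _].
have pred_int n : n.+1%:Z - 1 = n%:Z by lia.
pose u n := (length (F n%:Z%R) (ideal_mul J (F (n%:Z - 1)%R))
              - length (annihilator x `&` F (n%:Z - 1)%R) [set 0%R])%E.
(* Both lengths are finite, so the extended difference is the integer one. *)
have uE n : u n.+1 = (chern_term F x n)%:E.
  have [fB fK] := chern_term_finite noR max_m rad_I admF redF n.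
  by rewrite /u pred_int !lengthE // -EFinB.
have [n1 sumE] := sum_chern_term_eventually noR max_m rad_I admF redF.
have su : series_from1 u (chern_number F).
  (* The sum over [1 <= i < n.+1] becomes the sum of [chern_term] over [0 <= i < n], hence the
     shifted bound. *)
  exists n1.+1 => // -[//|n] /= len.
  by rewrite big_add1 /= (eq_bigr _ (fun i _ => uE i)) sumEFin sumE.
split=> // /(cohen_macaulay_dim1_nonzerodivisor dim1)[y my nzd].
(* A power of the nonzerodivisor [y] is a multiple of [x], so it kills [(0 : x)]; cancelling the
   factors [y] one by one leaves zero. *)
have K0 : annihilator x = [set 0].
  rewrite eqEsubset; split=> a; last by move=> ->; exact: ideal0 (is_annihilator x).
  move=> Ka; have [j [r _ eqy]] := pow_mem_reduction rad_I admF redF my.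
  have : y ^+ j * a = 0 by rewrite -eqy mulrAC [x * a]mulrC Ka mul0r.
  elim: j {eqy} => [|j IHj]; first by rewrite mul1r.
  by rewrite exprS -mulrA => /nzd.
have [n2 _ seru] := su; exists (maxn n1 n2) => // n /=.
rewrite geq_max => /andP[_ /seru /= <-]; apply: eq_big_nat => -[//|i] _.
(* With [(0 : x) = 0] the subtracted length is that of the zero module. *)
rewrite /u K0 pred_int setIidl; last first.
  by move=> _ ->; case: admF => /(_ i%:Z) /ideal0.
have i0 := @ideal_set0 R.
rewrite [length [set 0] _]lengthE ?(nat_length_self i0) ?sube0 //.
exact: finite_length_self.
Qed.
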